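(* Let $A\in\mathbb{R}^{m\times n}$ and let $k<\operatorname{rank}(A)$. Let $\hat V_k\in\mathbb{R}^{n\times k}$ be any matrix with $\hat V_k^T\hat V_k=I$ (the estimate of $V_k$ used in mGKS), and let $\mathcal{C}\subset\{1,\ldots,n\}$, $|\mathcal{C}|=k$, be the column subset computed by the mGKS algorithm with this $\hat V_k$. Then \[ \|A-P_{\mathcal{C}}A\|_2 \leq \eta_2\sqrt{1+k(n-k)}\,\sigma_{k+1}(A) \] and \[ \|A-P_{\mathcal{C}}A\|_F \leq \eta_F\sqrt{1+\frac{k(n-k)}{r_k}}\left(\sum_{i=k+1}^{\min(m,n)}\sigma_i(A)^2\right)^{1/2}, \] where \[ r_k=\frac{\|A(I-\hat V_k\hat V_k^T)\|_F^2}{\|A(I-\hat V_k\hat V_k^T)\|_2^2},\qquad \eta_2=\frac{\|A(I-\hat V_k\hat V_k^T)\|_2}{\|A(I-V_kV_k^T)\|_2},\qquad \eta_F=\frac{\|A(I-\hat V_k\hat V_k^T)\|_F}{\|A(I-V_kV_k^T)\|_F}. \]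
   Context: $\sigma_1(A)\ge\sigma_2(A)\ge\cdots\ge\sigma_{\min(m,n)}(A)$ are the singular values of $A$, and $V_k\in\mathbb{R}^{n\times k}$ has as columns the $k$ leading right singular vectors of $A$ (from an SVD of $A$). $\|\cdot\|_2$ is the spectral norm and $\|\cdot\|_F$ the Frobenius norm. For an index set $\mathcal{C}$, $A(:,\mathcal{C})$ is the submatrix of columns of $A$ indexed by $\mathcal{C}$, and $P_{\mathcal{C}}$ is the orthogonal projector onto the span of the columns of $A(:,\mathcal{C})$. Exact arithmetic is assumed. The mGKS algorithm: given $A$, $k$, and a matrix $\hat V_k\in\mathbb{R}^{n\times k}$ with orthonormal columns (an estimate of $V_k$), apply Bischof-Stewart pivoting (for $k$ steps) to the $k\times n$ matrix $\hat V_k^T$; return the set $\mathcal{C}$ of indices of the $k$ columns of $\hat V_k^T$ selected as pivots. Bischof-Stewart pivoting, applied to a matrix $B\in\mathbb{R}^{k\times n}$: columns are selected one at a time. Suppose $i$ columns have been selected, $0\le i<\min(k,n)$, and let $\Pi$ be a permutation matrix that moves the selected columns, in the order of selection, to the first $i$ positions. Write the partial QR factorization \[ B\Pi = \begin{bmatrix}Q_1 & Q_2\end{bmatrix}\begin{bmatrix}R_{11} & R_{12}\\ 0 & M\end{bmatrix}, \] with $\begin{bmatrix}Q_1 & Q_2\end{bmatrix}$ a $k\times k$ orthogonal matrix, $R_{11}\in\mathbb{R}^{i\times i}$ upper triangular, $R_{12}\in\mathbb{R}^{i\times(n-i)}$, and $M\in\mathbb{R}^{(k-i)\times(n-i)}$.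 The next pivot is the column of $B\Pi$ in position $i+j$, where $j\in\{1,\ldots,n-i\}$ minimizes \[ \frac{1+\|R_{11}^{-1}R_{12}e_j\|_2^2}{\|Me_j\|_2^2} \] over all $j$ with $Me_j\neq 0$; $e_j$ is the $j$-th standard basis vector. By convention, when $i=0$ the numerator is $1$, so the first pivot is a column of $B$ of largest Euclidean norm. Ties are broken arbitrarily. *)

(* Defs.v *)
From HB Require Import structures.
From mathcomp Require Import all_boot all_order all_algebra all_fingroup.
From mathcomp Require Import all_classical all_reals.

Set Implicit Arguments.
Unset Strict Implicit.
Unset Printing Implicit Defensive.

Import Order.TTheory GRing.Theory Num.Theory.
Local Open Scope ring_scope.

Section Norms.
Variable R : realType.

Definition l2norm n (x : 'cV[R]_n) : R := Num.sqrt (\sum_i x i 0 ^+ 2).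

Definition spectral_norm m n (A : 'M[R]_(m, n)) : R :=
  sup [set l2norm (A *m x) | x in [set x : 'cV[R]_n | l2norm x <= 1]]%classic.

Definition frobenius_norm m n (A : 'M[R]_(m, n)) : R :=
  Num.sqrt (\sum_i \sum_j A i j ^+ 2).

End Norms.

Section Decompositions.
Variable R : realType.

Definition orthogonal_mx n (Q : 'M[R]_n) : Prop := Q^T *m Q = 1%:M.

(* Singular values are numbered from 1 as usual: the i-th diagonal entry
   (i = 0, 1, ...) is sigma i.+1.  The values of sigma outside
   1, ..., min(m, n) are irrelevant. *)
Definition diag_sv m n (sigma : nat -> R) : 'M[R]_(m, n) :=
  \matrix_(i < m, j < n) (if (i : nat) == j then sigma i.+1 else 0).

Definition is_svd m n (A : 'M[R]_(m, n))
    (U : 'M[R]_m) (sigma : nat -> R) (V : 'M[R]_n) : Prop :=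
  [/\ orthogonal_mx U,
      orthogonal_mx V,
      forall i, (0 < i <= minn m n)%N -> 0 <= sigma i,
      forall i j, (0 < i)%N -> (i <= j <= minn m n)%N -> sigma j <= sigma i
    & A = U *m diag_sv m n sigma *m V^T].

Definition leading_cols n k (hk : (k <= n)%N) (V : 'M[R]_n) : 'M[R]_(n, k) :=
  colsub (widen_ord hk) V.

Definition cols_of m n (A : 'M[R]_(m, n)) (C : {set 'I_n}) : 'M[R]_(m, #|C|) :=
  colsub (fun i : 'I_#|C| => enum_val i) A.

(* [proj_mx] acts on row vectors, hence the transpositions; the row space of
   [kermx S] is { u | u *m S = 0 }, the orthogonal complement of the column
   space of S. *)
Definition orth_projector m p (S : 'M[R]_(m, p)) : 'M[R]_m :=
  (proj_mx <<S^T>>%MS (kermx S))^T.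

End Decompositions.

Section Pivoting.
Variables (R : realType) (k n : nat).

(* [bs_pivot B s c]: c is an admissible next pivot when the columns listed
   in s, in order of selection, are the ones already selected.  Column j of
   [col_perm pi B] is column [pi j] of B.  The permutation and the QR
   factorization are only required to exist, so nothing is assumed on which
   ones the algorithm uses. *)
Definition bs_pivot (B : 'M[R]_(k, n)) (s : seq 'I_n) (c : 'I_n) : Prop :=
  let i := size s in
  exists (ek : (i + (k - i) = k)%N) (en : (i + (n - i) = n)%N)
         (pi : 'S_n) (Q : 'M[R]_k)
         (R11 : 'M[R]_i) (R12 : 'M[R]_(i, n - i)) (M : 'M[R]_(k - i, n - i))
         (j : 'I_(n - i)),
    let crit (l : 'I_(n - i)) :=
      (1 + l2norm (col l (invmx R11 *m R12)) ^+ 2) / l2norm (col l M) ^+ 2 in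
    [/\ forall t : 'I_i,
          pi (cast_ord en (lshift (n - i) t)) = tnth (in_tuple s) t,
        orthogonal_mx Q,
        forall a b : 'I_i, (b < a)%N -> R11 a b = 0,
        col_perm pi B = Q *m castmx (ek, en) (block_mx R11 R12 0 M)
      & [/\ col j M != 0,
            forall l, col l M != 0 -> crit j <= crit l
          & c = pi (cast_ord en (rshift i j))]].

Inductive bs_pivots (B : 'M[R]_(k, n)) : seq 'I_n -> Prop :=
| BsNil : bs_pivots B [::]
| BsRcons s c : bs_pivots B s -> (size s < minn k n)%N -> bs_pivot B s c ->
    bs_pivots B (rcons s c).

Definition mgks_output (Vhat : 'M[R]_(n, k)) (C : {set 'I_n}) : Prop :=
  exists s : seq 'I_n,
    [/\ bs_pivots Vhat^T s, size s = k & C = [set c in s]%SET].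

End Pivoting.

Lemma ltn_rank_leq_col (R : realType) m n (A : 'M[R]_(m, n)) k :
  (k < \rank A)%N -> (k <= n)%N.
Proof. by move=> hk; apply: leq_trans (ltnW hk) (rank_leq_col A). Qed.

(* Main.v *)
Require Import Defs.
From mathcomp Require Import all_boot all_order all_algebra all_fingroup.
From mathcomp Require Import all_classical all_reals.
From mathcomp Require Import ring lra zify.

(** Write [V] for the n x k matrix with orthonormal columns on which the
    pivoting runs, [B = V^T], [E = A (1 - V V^T)], and [P] for the orthogonal
    projector onto the selected columns of [A].

    The pivoting is a greedy minimization.  If [L] is the left inverse of least
    Frobenius norm of the selected columns of [B], then selecting column [j]
    increases [|L|_F^2] by exactly the ratio
    [(1 + |R11^-1 R12 e_j|^2) / |M e_j|^2] which the pivot rule minimizes.  As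
    the rows of [B] are orthonormal, [|M|_F^2 = k - i] and
    [|R11^-1 R12|_F^2 = |R11^-1|_F^2 - i]; averaging the ratios with weights
    [|M e_j|^2] bounds the increment by
    [(n - 2 i + |R11^-1|_F^2) / (k - i)].  By induction, after [i] steps,
    [|L|_F^2 (k - i + 1) <= i (n - i + 1)]; the case [i = k] is
    [|L|_F^2 <= k (n - k + 1)] ([block_pivot_step], [bs_pivots_inverse],
    [mgks_inverse]).

    Padding [L] with zero rows at the unselected indices gives an n x k matrix
    [G] with [B G = 1], such that the columns of [A G] are combinations of
    selected columns of [A].  Hence [P A G = A G] and
    [A - P A = (1 - P) A (1 - G B) = (1 - P) (E - E W B)] where
    [W = (1 - V V^T) G = G - V] satisfies [|W|_F^2 = |G|_F^2 - k <= k (n - k)]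
    ([residual_factor]).  The factor [1 - P] is a contraction.  The row spaces
    of [E] and of [E W B] are orthogonal, so Pythagoras' theorem gives
    [|A - P A|_F^2 <= |E|_F^2 + |E|_2^2 k (n - k)] ([sqfro_residual_le]), and
    the Cauchy-Schwarz inequality gives
    [|A - P A|_2^2 <= |E|_2^2 (1 + k (n - k))] ([spectral_residual_le]).

    It remains to see that the denominators of the two ratios [eta] are at most
    the corresponding tails of singular values, and are nonzero: the first
    holds because [A (1 - V_k V_k^T) = U Sigma' V^T], where [Sigma'] is [Sigma]
    without its first [k] singular values ([sub_leading_svd]), the second
    because [A = A X X^T] with [X] of width [k] would force [\rank A <= k]. *)

Set Implicit Arguments.
Unset Strict Implicit.
Unset Printing Implicit Defensive.

Import Order.TTheory GRing.Theory Num.Theory.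
Local Open Scope ring_scope.

(** * Frobenius and spectral norms *)

Section SquaredNorm.
Variable R : realType.

(** The square of the Frobenius norm; on a column, that of the Euclidean norm. *)
Definition sqfro m n (A : 'M[R]_(m, n)) : R := \tr (A^T *m A).

Lemma sqfroE m n (A : 'M[R]_(m, n)) : sqfro A = \sum_i \sum_j A i j ^+ 2.
Proof.
rewrite exchange_big; apply: eq_bigr => j _; rewrite mxE.
by apply: eq_bigr => i _; rewrite mxE expr2.
Qed.

Lemma sqfro_ge0 m n (A : 'M[R]_(m, n)) : 0 <= sqfro A.
Proof. by rewrite sqfroE; do 2![apply: sumr_ge0 => ? _]; rewrite sqr_ge0. Qed.

Lemma sqfro_eq0 m n (A : 'M[R]_(m, n)) : (sqfro A == 0) = (A == 0).
Proof.
apply/eqP/eqP => [|->]; last by rewrite /sqfro mulmx0 mxtrace0.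
rewrite sqfroE => /eqP; rewrite psumr_eq0; last first.
  by move=> i _; apply: sumr_ge0 => ? _; rewrite sqr_ge0.
move=> /allP A0; apply/matrixP => i j; rewrite mxE.
have := A0 i (mem_index_enum _); rewrite psumr_eq0; last by move=> *; rewrite sqr_ge0.
by move=> /allP /(_ j (mem_index_enum _)); rewrite sqrf_eq0 => /eqP.
Qed.

Lemma sqfro_gt0 m n (A : 'M[R]_(m, n)) : (0 < sqfro A) = (A != 0).
Proof. by rewrite lt_def sqfro_ge0 andbT sqfro_eq0. Qed.

Lemma l2normE n (x : 'cV[R]_n) : l2norm x = Num.sqrt (sqfro x).
Proof.
by rewrite /l2norm sqfroE; congr Num.sqrt; apply: eq_bigr => i _; rewrite big_ord1.
Qed.

Lemma l2norm_sqr n (x : 'cV[R]_n) : l2norm x ^+ 2 = sqfro x.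
Proof. by rewrite l2normE sqr_sqrtr ?sqfro_ge0. Qed.

Lemma frobenius_normE m n (A : 'M[R]_(m, n)) :
  frobenius_norm A = Num.sqrt (sqfro A).
Proof. by rewrite sqfroE. Qed.

Lemma frobenius_norm_sqr m n (A : 'M[R]_(m, n)) : frobenius_norm A ^+ 2 = sqfro A.
Proof. by rewrite frobenius_normE sqr_sqrtr ?sqfro_ge0. Qed.

Lemma sqfro_tr m n (A : 'M[R]_(m, n)) : sqfro A^T = sqfro A.
Proof. by rewrite /sqfro trmxK mxtrace_mulC. Qed.

Lemma sqfro0 m n : sqfro (0 : 'M[R]_(m, n)) = 0.
Proof. by rewrite /sqfro mulmx0 mxtrace0. Qed.

Lemma sqfroN m n (A : 'M[R]_(m, n)) : sqfro (- A) = sqfro A.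
Proof. by rewrite !sqfroE; do 2![apply: eq_bigr => ? _]; rewrite mxE sqrrN. Qed.

Lemma sqfroZ m n a (A : 'M[R]_(m, n)) : sqfro (a *: A) = a ^+ 2 * sqfro A.
Proof.
rewrite !sqfroE mulr_sumr; apply: eq_bigr => i _; rewrite mulr_sumr.
by apply: eq_bigr => j _; rewrite mxE exprMn.
Qed.

Lemma sqfro1 n : sqfro (1%:M : 'M[R]_n) = n%:R.
Proof. by rewrite /sqfro trmx1 mulmx1 mxtrace1. Qed.

Lemma sqfro_mull_orth m n p (Q : 'M[R]_(m, n)) (A : 'M[R]_(n, p)) :
  Q^T *m Q = 1%:M -> sqfro (Q *m A) = sqfro A.
Proof. by move=> QQ; rewrite /sqfro trmx_mul mulmxA -(mulmxA A^T) QQ mulmx1. Qed.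

Lemma sqfro_mulr_orth m n p (A : 'M[R]_(m, n)) (Q : 'M[R]_(n, p)) :
  Q *m Q^T = 1%:M -> sqfro (A *m Q) = sqfro A.
Proof.
by move=> QQ; rewrite -sqfro_tr trmx_mul sqfro_mull_orth ?trmxK // sqfro_tr.
Qed.

(** Pythagoras' theorem, for matrices with orthogonal column spaces. *)
Lemma sqfro_addD m n (A B : 'M[R]_(m, n)) :
  A^T *m B = 0 -> sqfro (A + B) = sqfro A + sqfro B.
Proof.
move=> AB; rewrite /sqfro [(A + B)^T]linearD /= mulmxDl !mulmxDr AB.
have -> : B^T *m A = 0 by rewrite -[A]trmxK -trmx_mul AB trmx0.
by rewrite addr0 add0r mxtraceD.
Qed.

Lemma sqfro_row_mx m n p (A : 'M[R]_(m, n)) (B : 'M[R]_(m, p)) :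
  sqfro (row_mx A B) = sqfro A + sqfro B.
Proof. by rewrite /sqfro tr_row_mx mul_col_row mxtrace_block. Qed.

Lemma sqfro_col_mx m n p (A : 'M[R]_(m, n)) (B : 'M[R]_(p, n)) :
  sqfro (col_mx A B) = sqfro A + sqfro B.
Proof. by rewrite -sqfro_tr tr_col_mx sqfro_row_mx !sqfro_tr. Qed.

Lemma sqfro_cols m n (A : 'M[R]_(m, n)) : sqfro A = \sum_j sqfro (col j A).
Proof.
rewrite sqfroE exchange_big; apply: eq_bigr => j _; rewrite sqfroE.
by apply: eq_bigr => i _; rewrite big_ord1 mxE.
Qed.

Lemma sqfro_row_perm m n (s : 'S_m) (A : 'M[R]_(m, n)) :
  sqfro (row_perm s A) = sqfro A.
Proof.
rewrite row_permE sqfro_mull_orth // tr_perm_mx -perm_mxM mulVg.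
by rewrite perm_mx1.
Qed.

(** The Cauchy-Schwarz inequality, from Lagrange's identity. *)
Lemma sum_mul_sqr_le (I : finType) (f g : I -> R) :
  (\sum_i f i * g i) ^+ 2 <= (\sum_i f i ^+ 2) * (\sum_i g i ^+ 2).
Proof.
have : 0 <= \sum_i \sum_j (f i * g j - f j * g i) ^+ 2.
  by do 2![apply: sumr_ge0 => ? _]; rewrite sqr_ge0.
have -> : \sum_i \sum_j (f i * g j - f j * g i) ^+ 2 =
  (\sum_i f i ^+ 2) * (\sum_j g j ^+ 2) + (\sum_i g i ^+ 2) * (\sum_j f j ^+ 2)
   - 2 * ((\sum_i f i * g i) * (\sum_j f j * g j)).
  rewrite !big_distrlr /= mulr_sumr -big_split /= -sumrB; apply: eq_bigr => i _.
  rewrite mulr_sumr -big_split /= -sumrB; apply: eq_bigr => j _.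
  by ring.
nra.
Qed.

(** If |b|^2 <= w |y|^2 then |a + b|^2 <= (1 + w) (|a|^2 + |y|^2), by the
    Cauchy-Schwarz inequality; here q stands for |y|^2. *)
Lemma sqfro_add_le n (a b : 'cV[R]_n) (w q : R) :
  0 <= w -> 0 <= q -> sqfro b <= w * q -> sqfro (a + b) <= (1 + w) * (sqfro a + q).
Proof.
move=> w0 q0 bq; pose c := \sum_i a i 0 * b i 0.
have sqE (x : 'cV[R]_n) : sqfro x = \sum_i x i 0 ^+ 2.
  by rewrite sqfroE; apply: eq_bigr => i _; rewrite big_ord1.
have -> : sqfro (a + b) = sqfro a + sqfro b + 2 * c.
  rewrite !sqE mulr_sumr -!big_split /=; apply: eq_bigr => i _.
  by rewrite !mxE; ring.
have := sum_mul_sqr_le (fun i => a i 0) (fun i => b i 0); rewrite -/c -!sqE.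
move: (sqfro_ge0 a) bq; move: (sqfro a) (sqfro b) c => p b' c p0 bq cb.
have : `|2 * c| <= `|w * p + q|.
  rewrite -ler_sqr ?nnegrE // !real_normK ?num_real //.
  have : p * b' <= p * (w * q) by rewrite ler_wpM2l.
  have := sqr_ge0 (w * p - q); nra.
rewrite (ger0_norm (_ : 0 <= w * p + q)) ?addr_ge0 ?mulr_ge0 // ler_norml.
by move=> /andP[_]; nra.
Qed.
(** Submultiplicativity of the Frobenius norm. *)
Lemma sqfro_mul_le m n p (A : 'M[R]_(m, n)) (B : 'M[R]_(n, p)) :
  sqfro (A *m B) <= sqfro A * sqfro B.
Proof.
rewrite [leRHS]mulrC -(sqfro_tr B) !sqfroE mulrC big_distrlr /=.
do 2![apply: ler_sum => ? _]; rewrite mxE.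
under [X in _ <= _ * X]eq_bigr do rewrite mxE.
exact: sum_mul_sqr_le.
Qed.

(** The supremum defining the spectral norm is that of a nonempty bounded set. *)
Lemma spectral_has_sup m n (A : 'M[R]_(m, n)) :
  has_sup [set l2norm (A *m x) | x in [set x : 'cV[R]_n | l2norm x <= 1]]%classic.
Proof.
split; first by exists (l2norm (A *m 0)), 0 => //=; rewrite l2normE sqfro0 sqrtr0.
exists (Num.sqrt (sqfro A)) => _ /= [x x1 <-]; rewrite l2normE ler_sqrt ?sqfro_ge0 //.
apply: le_trans (sqfro_mul_le _ _) _; rewrite ler_piMr ?sqfro_ge0 //.
by rewrite -l2norm_sqr expr_le1 ?sqrtr_ge0.
Qed.

Lemma spectral_norm_ge0 m n (A : 'M[R]_(m, n)) : 0 <= spectral_norm A.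
Proof.
apply: le_trans (sqrtr_ge0 _) _; apply: (ub_le_sup (spectral_has_sup A).2).
by exists 0 => //=; rewrite l2normE sqfro0 sqrtr0.
Qed.

Lemma spectral_norm_leP m n (A : 'M[R]_(m, n)) (c : R) : 0 <= c ->
  (forall x : 'cV_n, sqfro (A *m x) <= c ^+ 2 * sqfro x) -> spectral_norm A <= c.
Proof.
move=> c0 Ac; apply: ge_sup; first exact: (spectral_has_sup A).1.
move=> _ /= [x x1 <-]; rewrite -(ler_pXn2r (n := 2)) ?nnegrE ?sqrtr_ge0 //.
rewrite l2norm_sqr; apply: le_trans (Ac x) _; rewrite ler_piMr ?sqr_ge0 //.
by rewrite -l2norm_sqr expr_le1 ?sqrtr_ge0.
Qed.

(** A matrix product is a family of matrix-vector products, so the spectral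
    norm of the left factor bounds the Frobenius norm as well. *)
Lemma sqfro_mul_spectral m n p (A : 'M[R]_(m, n)) (B : 'M[R]_(n, p)) :
  sqfro (A *m B) <= spectral_norm A ^+ 2 * sqfro B.
Proof.
rewrite sqfro_cols (sqfro_cols B) mulr_sumr; apply: ler_sum => j _.
rewrite colE -mulmxA -colE; set x := col j B.
have [x0|xn0] := eqVneq (sqfro x) 0.
  move/eqP: (x0); rewrite sqfro_eq0 => /eqP ->.
  by rewrite mulmx0 !sqfro0 mulr0.
have x0 : 0 < sqfro x by rewrite lt_def xn0 sqfro_ge0.
pose t := (l2norm x)^-1.
have nx : 0 < l2norm x by rewrite l2normE sqrtr_gt0.
have t2 : t ^+ 2 * sqfro x = 1 by rewrite /t exprVn l2norm_sqr mulVf.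
have : l2norm (A *m (t *: x)) <= spectral_norm A.
  apply: (ub_le_sup (spectral_has_sup A).2); exists (t *: x) => //=.
  by rewrite l2normE sqfroZ t2 sqrtr1.
move=> le_xA; have := lerXn2r 2 (sqrtr_ge0 _) (spectral_norm_ge0 A) le_xA.
rewrite -/(l2norm _) l2norm_sqr -scalemxAr sqfroZ.
by rewrite /t exprVn l2norm_sqr mulrC ler_pdivrMr.
Qed.

Lemma spectral_norm_gt0 m n (A : 'M[R]_(m, n)) : A != 0 -> 0 < spectral_norm A.
Proof.
move=> A0; rewrite lt_def spectral_norm_ge0 andbT; apply: contraNneq A0 => s0.
have := sqfro_mul_spectral A 1%:M; rewrite s0 mulmx1 expr0n mul0r -sqfro_eq0.
by move=> h; rewrite eq_le h sqfro_ge0.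
Qed.
End SquaredNorm.

(** * One pivoting step *)

Section Step.
Variable R : realType.

(** One pivoting step in coordinates where the selected columns come first and
    the orthogonal factor is the identity: X is the block triangular factor,
    and G is a left inverse of the selected columns of X, padded with zero rows.
    The new left inverse, padded in the same way, is made of the rows
    [R11^-1, - R11^-1 r m^T / |m|^2] and [0, m^T / |m|^2], where r and m are
    the columns j of R12 and M. *)
Lemma block_pivot_step i k n (R11 : 'M[R]_i) (R12 : 'M[R]_(i, n))
    (M : 'M[R]_(k, n)) (j : 'I_n) (G : 'M[R]_(i + n, i + k)) :
  let X := block_mx R11 R12 0 M in
  let crit l := (1 + sqfro (col l (invmx R11 *m R12))) / sqfro (col l M) in
  X *m X^T = 1%:M -> col j M != 0 ->
  (forall l, col l M != 0 -> crit j <= crit l) ->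
  dsubmx G = 0 -> lsubmx (G *m X) = col_mx 1%:M 0 ->
  sqfro G * k.+1%:R <= (i * n.+1)%:R ->
  exists G' : 'M[R]_(i + n, i + k),
    [/\ forall l, l != j -> row (rshift i l) G' = 0,
        lsubmx (G' *m X) = col_mx 1%:M 0,
        col (rshift i j) (G' *m X) = col (rshift i j) 1%:M
      & sqfro G' * k%:R <= (i.+1 * n)%:R].
Proof.
move=> X crit XX Mj critP Gd GX normG.
pose Y := invmx R11.
have [Y1 [Y2 GE]] : exists Y1 Y2, G = block_mx Y1 Y2 0 0.
  exists (ulsubmx G), (ursubmx G); rewrite -{1}(submxK G); congr block_mx.
    by apply/matrixP => a b; have /matrixP/(_ a (lshift _ b)) := Gd; rewrite !mxE.
  by apply/matrixP => a b; have /matrixP/(_ a (rshift _ b)) := Gd; rewrite !mxE.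
have Y1R : Y1 *m R11 = 1%:M.
  move: GX; rewrite GE mulmx_block !mul0mx !mulmx0 !addr0.
  by rewrite block_mxEh row_mxKl => /eq_col_mx [].
have [Y1u Ru] := mulmx1_unit Y1R.
have Y1E : Y1 = Y by rewrite -[Y1]mulmx1 -(mulmxV Ru) mulmxA Y1R mul1mx.
have YR : Y *m R11 = 1%:M by rewrite mulVmx.
(* The top left block of G is R11^-1, so the bound on G passes to the left
   inverse of least norm. *)
have normY : sqfro Y * k.+1%:R <= (i * n.+1)%:R.
  apply: le_trans normG; rewrite ler_pM2r ?ltr0n // -Y1E GE block_mxEv row_mx0.
  by rewrite sqfro_col_mx sqfro_row_mx sqfro0 addr0 lerDl sqfro_ge0.
move: XX; rewrite tr_block_mx mulmx_block scalar_mx_block trmx0 !mulmx0 !mul0mx !add0r.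
case/eq_block_mx => XX1 _ _ XX2.
have sqM : sqfro M = k%:R by rewrite -sqfro_tr /sqfro trmxK XX2 mxtrace1.
have sqYR : sqfro (Y *m R12) = sqfro Y - i%:R.
  rewrite -(sqfro1 R i) -YR -sqfro_tr -(sqfro_tr Y) -(sqfro_tr (Y *m R11)).
  rewrite /sqfro !trmxK !trmx_mul.
  have -> : Y *m R12 *m (R12^T *m Y^T) = Y *m Y^T - Y *m R11 *m (R11^T *m Y^T).
    have -> : Y *m Y^T = Y *m (R11 *m R11^T + R12 *m R12^T) *m Y^T.
      by rewrite XX1 mulmx1.
    by rewrite mulmxDr mulmxDl !mulmxA addrAC subrr add0r.
  by rewrite linearB.
have sqMj : 0 < sqfro (col j M) by rewrite sqfro_gt0.
(* The weighted average: the minimality of crit j, multiplied by |M e_l|^2 and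
   summed over l; the columns l with M e_l = 0 contribute 0 to the left. *)
have crit_le : crit j * k%:R <= n%:R + sqfro Y - i%:R.
  rewrite -addrA -sqYR -sqM (sqfro_cols M) (sqfro_cols (Y *m R12)) mulr_sumr.
  rewrite -[X in X%:R + _](card_ord n) -sumr_const -big_split /=.
  apply: ler_sum => l _; have [->|Ml] := eqVneq (col l M) 0.
    by rewrite sqfro0 mulr0 addr_ge0 ?sqfro_ge0 ?ler01.
  by rewrite -ler_pdivlMr ?sqfro_gt0 //; exact: critP.
(* w is the Moore-Penrose inverse of column j of M. *)
pose w : 'rV_k := (sqfro (col j M))^-1 *: (col j M)^T.
have wM : w *m col j M = 1%:M.
  apply/matrixP => a b; rewrite !ord1 /w -scalemxAl mxE.
  have -> : ((col j M)^T *m col j M) 0 0 = sqfro (col j M).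
    by rewrite /sqfro /mxtrace big_ord1.
  by rewrite mulVf ?gt_eqF // mxE eqxx.
have sqw : sqfro w = (sqfro (col j M))^-1.
  by rewrite sqfroZ sqfro_tr expr2 -mulrA mulVf ?gt_eqF // mulr1.
have sqmw p (x : 'cV[R]_p) : sqfro (x *m w) = sqfro x * sqfro w.
  rewrite /sqfro trmx_mul mulmxA -(mulmxA w^T) (mx11_scalar (x^T *m x)).
  rewrite mul_mx_scalar -scalemxAl mxtraceZ; congr (_ * _).
  by rewrite mxtrace_scalar.
pose z := Y *m col j R12.
exists (block_mx Y (- (z *m w)) 0 (delta_mx j 0 *m w)).
have GX' : block_mx Y (- (z *m w)) 0 (delta_mx j 0 *m w) *m X =
    block_mx 1%:M (Y *m R12 - z *m w *m M) 0 (delta_mx j 0 *m w *m M).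
  by rewrite mulmx_block YR !mulmx0 !mul0mx !addr0 !add0r mulNmx.
split.
- move=> l lj; rewrite block_mxEv rowKd row_row_mx row0 row_mul.
  suff -> : row l (delta_mx j 0 : 'cV[R]_n) = 0 by rewrite mul0mx row_mx0.
  by apply/rowP => b; rewrite !mxE (negPf lj).
- by rewrite GX' block_mxEh row_mxKl.
- rewrite GX' block_mxEh colKr scalar_mx_block block_mxEh colKr !col_col_mx; congr col_mx.
    rewrite linearB /= !colE -!mulmxA -(colE j M) wM mulmx1 -colE.
    by rewrite /z subrr; apply/colP => a; rewrite !mxE big1 // => b _; rewrite !mxE mul0r.
  by rewrite !colE -!mulmxA -(colE j M) wM mulmx1 mul1mx.
rewrite block_mxEv sqfro_col_mx !sqfro_row_mx sqfroN sqfro0 add0r !sqmw.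
have -> : sqfro (delta_mx j 0 : 'cV[R]_n) = 1.
  rewrite sqfroE (bigD1 j) //= big_ord1 mxE !eqxx expr1n big1 ?addr0 // => l lj.
  by rewrite big_ord1 mxE (negPf lj) expr0n.
move: crit_le; rewrite /crit -sqw -/Y.
have -> : col j (Y *m R12) = z by rewrite /z !colE mulmxA.
move: normY; rewrite !natrM -[k.+1%:R]natr1 -[n.+1%:R]natr1 -[i.+1%:R]natr1.
move: (sqfro Y) (sqfro z) (sqfro w) => y zz ww.
by lra.
Qed.
End Step.

(** * The pivoting algorithm *)

Section Pivots.
Variable R : realType.

(** G is a left inverse of the columns of B listed in s, extended by zero rows
    at the indices outside s; keeping n rows avoids matrices whose size
    depends on s.  Row c of G is the row of the left inverse that corresponds
    to column c of B. *)
Definition selection_inverse k n (B : 'M[R]_(k, n)) (s : seq 'I_n)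
    (G : 'M[R]_(n, k)) : Prop :=
  (forall a, a \notin s -> row a G = 0) /\
  (forall c, c \in s -> col c (G *m B) = col c 1%:M).

Lemma mul_row_col_perm k n p (pi : 'S_n) (G : 'M[R]_(n, k)) (B : 'M[R]_(k, p))
    (tau : 'S_p) :
  row_perm pi G *m col_perm tau B = row_perm pi (col_perm tau (G *m B)).
Proof.
by apply/matrixP => a b; rewrite !mxE; apply: eq_bigr => l _; rewrite !mxE.
Qed.

(** One pivoting step for a partial QR factorization: the permutation and the
    orthogonal factor are absorbed in G, which changes no norm.  The sizes
    k and n are kept apart from i + k' and i + n' so that the lemma applies to
    k' = k - i and n' = n - i. *)
Lemma pivot_step_QR i k' n' k n (ek : (i + k' = k)%N) (en : (i + n' = n)%N)
    (B : 'M[R]_(k, n)) (s : seq 'I_n) (f : 'I_i -> 'I_n) (pi : 'S_n)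
    (Q : 'M[R]_k) (R11 : 'M[R]_i) (R12 : 'M[R]_(i, n')) (M : 'M[R]_(k', n'))
    (j : 'I_n') (G : 'M[R]_(n, k)) :
  let crit l := (1 + sqfro (col l (invmx R11 *m R12))) / sqfro (col l M) in
  B *m B^T = 1%:M -> orthogonal_mx Q ->
  (forall c, reflect (exists t, c = f t) (c \in s)) ->
  (forall t, pi (cast_ord en (lshift n' t)) = f t) ->
  col_perm pi B = Q *m castmx (ek, en) (block_mx R11 R12 0 M) ->
  col j M != 0 -> (forall l, col l M != 0 -> crit j <= crit l) ->
  selection_inverse B s G -> sqfro G * k'.+1%:R <= (i * n'.+1)%:R ->
  exists2 G' : 'M[R]_(n, k),
    selection_inverse B (rcons s (pi (cast_ord en (rshift i j)))) G'
    & sqfro G' * k'%:R <= (i.+1 * n')%:R.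
Proof.
move=> crit; rewrite {}/crit.
case: k / ek B Q G => B Q G; case: n / en B s f pi G => B s f pi G.
rewrite castmx_id => BB QQ sP pif BE Mj critP [Gs GB] normG.
have QQ' : Q *m Q^T = 1%:M by apply: mulmx1C.
pose X := block_mx R11 R12 0 M.
have XE : X = Q^T *m col_perm pi B by rewrite BE mulmxA QQ mul1mx.
have XX : X *m X^T = 1%:M.
  rewrite XE trmx_mul trmxK tr_col_perm mulmxA -(mulmxA Q^T).
  have -> : col_perm pi B *m row_perm pi B^T = B *m B^T.
    by rewrite row_permE col_permE mulmxA -(mulmxA B) -perm_mxM mulVg perm_mx1 mulmx1.
  by rewrite BB mulmx1.
pose G0 := row_perm pi G *m Q.
have lpi t : pi (lshift n' t) = f t by rewrite -pif cast_ord_id.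
have rpi l : pi (rshift i l) \notin s.
  apply/sP => -[t]; rewrite -lpi => /perm_inj/eqP.
  by rewrite eq_sym eq_lrshift.
have G0X : G0 *m X = row_perm pi (col_perm pi (G *m B)).
  by rewrite -mul_row_col_perm XE mulmxA -(mulmxA _ Q) QQ' mulmx1.
have GBf a t : (G *m B) a (f t) = (a == f t)%:R.
  have /colP/(_ a) := GB (f t) (introT (sP _) (ex_intro _ t erefl)).
  by rewrite mxE => ->; rewrite !mxE.
have [|||G1 [G1r G1l G1j G1n]] := block_pivot_step XX Mj critP (G := G0).
- apply/row_matrixP => l; rewrite row0 row_dsubmx row_mul.
  suff -> : row (rshift i l) (row_perm pi G) = 0 by rewrite mul0mx.
  by rewrite -(Gs _ (rpi l)); apply/rowP => b; rewrite !mxE.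
- rewrite -/X G0X; apply/matrixP => a t.
  rewrite [LHS]mxE [LHS]mxE [LHS]mxE lpi GBf -lpi (inj_eq perm_inj).
  have -> : col_mx 1%:M 0 a t = (1%:M : 'M[R]_(i + n')) a (lshift n' t).
    by rewrite scalar_mx_block block_mxEh row_mxEl.
  by rewrite mxE.
- by rewrite sqfro_mulr_orth // sqfro_row_perm.
exists (row_perm pi^-1 (G1 *m Q^T)); last first.
  by rewrite sqfro_row_perm sqfro_mulr_orth // trmxK.
have G1B a b : (row_perm pi^-1 (G1 *m Q^T) *m B) (pi a) (pi b) = (G1 *m X) a b.
  rewrite XE mulmxA !mxE; apply: eq_bigr => l _.
  by congr (_ * _); [rewrite [LHS]mxE permK | rewrite [RHS]mxE].
rewrite cast_ord_id; split=> [a|c].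
  rewrite -(permKV pi a) mem_rcons inE negb_or (inj_eq perm_inj).
  set b := (pi^-1)%g a => /andP[bj bs].
  have -> : row (pi b) (row_perm pi^-1 (G1 *m Q^T)) = row b (G1 *m Q^T).
    by apply/rowP => l; rewrite [LHS]mxE [LHS]mxE permK [RHS]mxE.
  rewrite row_mul; case: (split_ordP b) bj bs => [t ->|l ->].
    by rewrite lpi => _ /negP[]; apply/sP; exists t.
  by rewrite eq_rshift => lj _; rewrite G1r // mul0mx.
rewrite mem_rcons inE => cP; apply/colP => a.
rewrite -(permKV pi a); set b := (pi^-1)%g a.
rewrite mxE [RHS]mxE [RHS]mxE.
have -> : (pi b == c) = (b == (pi^-1)%g c) by rewrite -{1}(permKV pi c) (inj_eq perm_inj).
case/orP: cP => [/eqP->|/sP[t ->]].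
  rewrite G1B permK; move/colP/(_ b): G1j.
  by rewrite mxE => ->; rewrite !mxE.
rewrite -lpi G1B permK.
have -> : (G1 *m X) b (lshift n' t) = lsubmx (G1 *m X) b t by rewrite [RHS]mxE.
rewrite G1l.
have -> : col_mx 1%:M 0 b t = (1%:M : 'M[R]_(i + n')) b (lshift n' t).
  by rewrite scalar_mx_block block_mxEh row_mxEl.
by rewrite mxE.
Qed.

Lemma bs_pivot_step k n (B : 'M[R]_(k, n)) s c G :
  B *m B^T = 1%:M -> (size s < minn k n)%N -> bs_pivot B s c ->
  selection_inverse B s G ->
  sqfro G * (k - size s).+1%:R <= (size s * (n - size s).+1)%:R ->
  exists2 G', selection_inverse B (rcons s c) G' &
  sqfro G' * (k - (size s).+1).+1%:R <= ((size s).+1 * (n - (size s).+1).+1)%:R.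
Proof.
move=> BB; rewrite leq_min => /andP[sk sn] [ek [en [pi [Q [R11 [R12 [M [j]]]]]]]] /=.
move=> [pis QQ _ BE [Mj critP ->]] Gs normG; rewrite !subnSK //.
apply: (pivot_step_QR BB QQ _ pis BE Mj _ Gs normG) => [c'|l Ml].
  exact: (tnthP (in_tuple s)).
by have := critP l Ml; rewrite !l2norm_sqr.
Qed.

(** The invariant of the algorithm: |G|_F^2 (k - i + 1) <= i (n - i + 1) after
    i steps. *)
Lemma bs_pivots_inverse k n (B : 'M[R]_(k, n)) s :
  B *m B^T = 1%:M -> bs_pivots B s ->
  exists2 G, selection_inverse B s G &
    sqfro G * (k - size s).+1%:R <= (size s * (n - size s).+1)%:R.
Proof.
move=> BB; elim=> [|t c _ [G Gt normG] tk tc].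
  by exists 0; [split=> // a _; rewrite row0 | rewrite sqfro0 mul0r].
by rewrite size_rcons; apply: bs_pivot_step tc Gt normG.
Qed.

Lemma bs_pivots_uniq k n (B : 'M[R]_(k, n)) s : bs_pivots B s -> uniq s.
Proof.
elim=> //= t c _ tu _ [ek [en [pi [Q [R11 [R12 [M [j]]]]]]]] /= [pit _ _ _ [_ _ ->]].
rewrite rcons_uniq tu andbT; apply/(tnthP (in_tuple t)) => -[l].
rewrite -pit => /perm_inj/cast_ord_inj/eqP.
by rewrite eq_sym eq_lrshift.
Qed.

(** Once k distinct columns are selected, the selected block of B is square, so
    its left inverse is also a right inverse. *)
Lemma selection_inverse_mul1 k n (B : 'M[R]_(k, n)) s G :
  size s = k -> uniq s -> selection_inverse B s G -> B *m G = 1%:M.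
Proof.
move=> sk su [Gs GB]; pose f (t : 'I_k) := tnth (Tuple (introT eqP sk)) t.
have fP c : reflect (exists t, c = f t) (c \in s) by exact: tnthP.
have f_inj : injective f by apply/tuple_uniqP.
have inv : rowsub f G *m colsub f B = 1%:M.
  apply/matrixP => a b; have fb : f b \in s by apply/fP; exists b.
  have /colP/(_ (f a)) := GB _ fb; rewrite mxE [RHS]mxE [RHS]mxE (inj_eq f_inj).
  rewrite mxE => GBE; rewrite !mxE -{}GBE.
  by apply: eq_bigr => l _; rewrite !mxE.
rewrite -(mulmx1C inv); apply/matrixP => a b; rewrite !mxE.
rewrite (bigID (mem s)) /= addrC big1 ?add0r => [|c cs]; last first.
  by have /rowP/(_ b) := Gs _ cs; rewrite !mxE => ->; rewrite mulr0.
rewrite -big_uniq //= -[s in LHS]/(val (Tuple (introT eqP sk))) big_tuple.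
by apply: eq_bigr => l _; rewrite !mxE.
Qed.

Lemma mgks_inverse k n (Vhat : 'M[R]_(n, k)) (C : {set 'I_n}) :
  Vhat^T *m Vhat = 1%:M -> mgks_output Vhat C ->
  exists G : 'M[R]_(n, k),
    [/\ Vhat^T *m G = 1%:M, forall a, a \notin C -> row a G = 0
      & sqfro G <= (k * (n - k).+1)%:R].
Proof.
move=> VV [s [Bs sk ->]].
have [|G Gs normG] := bs_pivots_inverse _ Bs; first by rewrite trmxK.
exists G; split.
- exact: selection_inverse_mul1 sk (bs_pivots_uniq Bs) Gs.
- by move=> a; rewrite inE; apply: Gs.1.
by move: normG; rewrite sk subnn mulr1.
Qed.
End Pivots.

(** * Orthogonal projectors *)

Section Projector.
Variables (R : realType) (m p : nat) (S : 'M[R]_(m, p)).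
Let P := orth_projector S.

Lemma capmx_tr_kermx : (<<S^T>> :&: kermx S = 0)%MS.
Proof.
apply/eqP/rowV0P => u; rewrite sub_capmx genmxE => /andP[/submxP[D uE] /sub_kermxP uS].
apply/eqP; rewrite -sqfro_eq0 -sqfro_tr /sqfro trmxK [in u^T]uE.
by rewrite trmx_mul trmxK mulmxA uS mul0mx mxtrace0.
Qed.

Lemma orth_projector_id q (Y : 'M[R]_(p, q)) : P *m (S *m Y) = S *m Y.
Proof.
rewrite mulmxA; congr (_ *m _); apply: trmx_inj; rewrite trmx_mul trmxK.
by rewrite proj_mx_id ?capmx_tr_kermx // genmxE.
Qed.

(** Every row is the sum of one in the row space of S^T and one orthogonal to
    it, so proj_mx does define the orthogonal projection. *)
Lemma addsmx_tr_kermx q (Y : 'M[R]_(q, m)) : (Y <= <<S^T>> + kermx S)%MS.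
Proof.
apply: submx_full; rewrite /row_full mxrank_disjoint_sum ?capmx_tr_kermx //.
by rewrite genmxE mxrank_tr mxrank_ker subnKC ?rank_leq_row.
Qed.

Lemma sqfro_projectorC_le q (Y : 'M[R]_(m, q)) : sqfro (Y - P *m Y) <= sqfro Y.
Proof.
rewrite -[in leRHS](subrK (P *m Y) Y) (sqfro_addD (B := P *m Y)) ?lerDl ?sqfro_ge0 //.
have := proj_mx_compl_sub (addsmx_tr_kermx Y^T).
have := proj_mx_sub <<S^T>>%MS (kermx S) Y^T; rewrite genmxE => /submxP[D PE].
move/sub_kermxP; have <- : (P *m Y)^T = Y^T *m proj_mx <<S^T>>%MS (kermx S).
  by rewrite trmx_mul trmxK.
rewrite -linearB /= => YS.
have PY : P *m Y = S *m D^T.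
  by apply: trmx_inj; rewrite trmx_mul trmxK trmx_mul trmxK PE.
by rewrite {2}PY mulmxA YS mul0mx.
Qed.
End Projector.

(** * The singular value tail *)

Section Tail.
Variable R : realType.

Lemma sub_rank_neq0 m n k (A : 'M[R]_(m, n)) (X : 'M[R]_(n, k)) :
  (k < \rank A)%N -> A *m (1%:M - X *m X^T) != 0.
Proof.
apply: contraTneq => /eqP; rewrite mulmxBr mulmx1 subr_eq0 => /eqP ->.
by rewrite -leqNgt mulmxA (leq_trans (mxrankM_maxl _ _)) // rank_leq_col.
Qed.

(** The diagonal factor of a singular value decomposition, with the singular
    values sigma 1, ..., sigma k replaced by 0. *)
Definition tail_sv m n k (sigma : nat -> R) : 'M[R]_(m, n) :=
  diag_sv m n (fun i => if (k < i)%N then sigma i else 0).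

Lemma sub_leading_svd m n k (A : 'M[R]_(m, n)) U sigma V (hk : (k <= n)%N) :
  is_svd A U sigma V -> let Vk := leading_cols hk V in
  A *m (1%:M - Vk *m Vk^T) = U *m tail_sv m n k sigma *m V^T.
Proof.
move=> [_ VV _ _ AE] Vk.
(* J selects the first k columns: J J^T is diagonal, with k leading ones. *)
pose J : 'M[R]_(n, k) := colsub (widen_ord hk) 1%:M.
have VkE : Vk = V *m J.
  rewrite /Vk /leading_cols -[in LHS](mulmx1 V).
  by apply/matrixP => a b; rewrite !mxE; apply: eq_bigr => l _; rewrite !mxE.
have JJ i j : (J *m J^T) i j = ((i == j) && (i < k)%N)%:R.
  rewrite mxE; have [ik|ki] := ltnP i k; last first.
    rewrite andbF big1 // => t _; rewrite !mxE.
    case: eqP => [it|_]; last by rewrite mul0r.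
    by move: ki; rewrite it /= leqNgt ltn_ord.
  rewrite (bigD1 (Ordinal ik)) //= big1 => [|t tk].
    rewrite !mxE addr0 andbT eq_sym.
    have -> : widen_ord hk (Ordinal ik) = i by apply: val_inj.
    by rewrite eqxx mul1r eq_sym.
  rewrite !mxE; case: eqP => [it|_]; last by rewrite mul0r.
  by case/eqP: tk; apply: val_inj; rewrite /= it.
have QE i j : (1%:M - J *m J^T) i j = ((i == j) && (k <= i)%N)%:R.
  rewrite mxE [in X in _ + X]mxE JJ mxE.
  by case: eqP => _; case: ltnP => _; rewrite /= ?subr0 ?subrr.
rewrite AE VkE trmx_mul -!mulmxA; congr (U *m _).
rewrite mulmxBr mulmx1 !mulmxA VV mul1mx -(mulmxA J).
rewrite -{1}(mul1mx V^T) mulmxA -mulmxBl mulmxA.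
congr (_ *m _); apply/matrixP => i j; rewrite mxE (bigD1 j) //= big1 => [|l lj].
  rewrite QE eqxx addr0 !mxE /= ltnS.
  case: eqP => [->|_]; last by rewrite mul0r.
  by case: leqP => _; rewrite ?mulr0 ?mulr1.
by rewrite QE (negPf lj) mulr0.
Qed.

Lemma sqfro_tail_sv m n k sigma :
  sqfro (tail_sv m n k sigma) = \sum_(k.+1 <= i < (minn m n).+1) sigma i ^+ 2.
Proof.
rewrite sqfroE big_add1 /=.
rewrite (big_nat_widenl _ 0) // (big_nat_widen _ _ m) ?geq_minl // big_mkord.
rewrite [RHS]big_mkcond; apply: eq_bigr => i _ /=; rewrite leq_min ltn_ord /=.
have [ni|ni] := ltnP i n; last first.
  rewrite andbF big1 // => j _; rewrite !mxE ifF ?expr0n //.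
  by apply/negbTE; apply: contraTneq ni => ->; rewrite -ltnNge.
rewrite (bigD1 (Ordinal ni)) //= big1 => [|j ji].
  by rewrite !mxE /= eqxx addr0 andbT ltnS; case: ifP; rewrite // expr0n.
rewrite !mxE ifF ?expr0n //; apply/negbTE; apply: contraNneq ji => ij.
by apply/eqP/val_inj.
Qed.

Lemma sqfro_tail_mul_le m n k sigma (y : 'cV[R]_n) :
  (forall i, (0 < i <= minn m n)%N -> 0 <= sigma i) ->
  (forall i j, (0 < i)%N -> (i <= j <= minn m n)%N -> sigma j <= sigma i) ->
  sqfro (tail_sv m n k sigma *m y) <= sigma k.+1 ^+ 2 * sqfro y.
Proof.
move=> sigma_ge0 sigma_dec; set T := tail_sv _ _ _ _.
have T0 (i : 'I_m) (j : 'I_n) : (i : nat) != j -> T i j = 0.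
  by move=> ij; rewrite mxE (negPf ij).
have Tle (i : 'I_m) (j : 'I_n) : T i j ^+ 2 <= sigma k.+1 ^+ 2.
  rewrite mxE; case: eqP => [ij|_]; last by rewrite expr0n sqr_ge0.
  case: ltnP => [ki|_]; last by rewrite expr0n sqr_ge0.
  have imn : (i < minn m n)%N by rewrite leq_min ltn_ord ij ltn_ord.
  apply: lerXn2r; rewrite ?nnegrE; [|  |apply: sigma_dec; lia]; apply: sigma_ge0; lia.
rewrite (sqfroE y) mulr_sumr sqfroE.
(* A row of T has at most one nonzero entry, so squaring commutes with the sum
   over the columns. *)
have -> : \sum_i \sum_j (T *m y) i j ^+ 2 = \sum_j \sum_i (T i j * y j 0) ^+ 2.
  rewrite [RHS]exchange_big; apply: eq_bigr => i _; rewrite big_ord1 mxE.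
  have [ni|ni] := ltnP i n.
    rewrite [in LHS](bigD1 (Ordinal ni)) //= [in RHS](bigD1 (Ordinal ni)) //=.
    rewrite !big1 ?addr0 // => j ji; rewrite T0 ?mul0r ?expr0n //.
      by apply: contraNneq ji => ij; apply/eqP/val_inj.
    by apply: contraNneq ji => ij; apply/eqP/val_inj.
  have ij (j : 'I_n) : (i : nat) != j by apply: contraTneq ni => ->; rewrite -ltnNge.
  by rewrite !big1 ?expr0n // => j _; rewrite T0 // mul0r ?expr0n.
apply: ler_sum => j _; rewrite big_ord1.
have [mj|mj] := ltnP j m.
  rewrite (bigD1 (Ordinal mj)) //= big1 => [|i ij].
    by rewrite addr0 exprMn ler_wpM2r ?sqr_ge0.
  by rewrite T0 ?mul0r ?expr0n.
rewrite big1 => [|i _]; first by apply: mulr_ge0; exact: sqr_ge0.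
rewrite T0 ?mul0r ?expr0n //.
by apply: contraTneq mj => <-; rewrite -ltnNge.
Qed.

End Tail.

(** * The error of the column subset *)

Section Residual.
Variables (R : realType) (m n k : nat) (A : 'M[R]_(m, n)).
Variables (V : 'M[R]_(n, k)) (C : {set 'I_n}).
Hypotheses (VV : V^T *m V = 1%:M) (hC : mgks_output V C).

Let E := A *m (1%:M - V *m V^T).
Let D := A - orth_projector (cols_of A C) *m A.

(** A - P A = (1 - P) (E - E W V^T), where 1 - P is a contraction. *)
Lemma residual_factor :
  exists2 W : 'M[R]_(n, k), sqfro W <= (k * (n - k))%:R &
  forall p (x : 'M[R]_(n, p)), sqfro (D *m x) <= sqfro ((E - E *m W *m V^T) *m x).
Proof.
have [G [VG GC normG]] := mgks_inverse VV hC.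
pose W := (1%:M - V *m V^T) *m G; exists W => [|p x].
  have WE : W = G - V by rewrite /W mulmxBl mul1mx -mulmxA VG mulmx1.
  have : sqfro G = sqfro W + k%:R.
    rewrite -[in LHS](subrK V G) -WE sqfro_addD.
      by rewrite {2}/sqfro VV mxtrace1.
    by rewrite WE linearB /= mulmxBl VV -[G^T *m V]trmxK trmx_mul trmxK VG trmx1 subrr.
  by move=> GE; move: normG; rewrite GE mulnS natrD addrC lerD2l.
have AGS : A *m G = cols_of A C *m rowsub enum_val G.
  apply/matrixP => a b; rewrite !mxE (bigID (mem C)) /= addrC big1 ?add0r => [|c cC].
    by rewrite big_enum_val; apply: eq_bigr => t _; rewrite !mxE.
  by have /rowP/(_ b) := GC _ cC; rewrite !mxE => ->; rewrite mulr0.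
have EW : E - E *m W *m V^T = A - A *m G *m V^T.
  have QV : (1%:M - V *m V^T) *m (1%:M - V *m V^T) = 1%:M - V *m V^T.
    by rewrite mulmxBr mulmx1 mulmxBl mul1mx mulmxA -(mulmxA V V^T) VV mulmx1 subrr subr0.
  rewrite /E /W -!mulmxA (mulmxA (1%:M - V *m V^T) (1%:M - V *m V^T)) QV.
  rewrite (mulmxBl 1%:M) mul1mx -(mulmxA V V^T) (mulmxA V^T) VG mul1mx.
  by rewrite !mulmxBr !mulmx1 opprB addrA subrK.
suff -> : D *m x = (E - E *m W *m V^T) *m x -
    orth_projector (cols_of A C) *m ((E - E *m W *m V^T) *m x).
  exact: sqfro_projectorC_le.
rewrite EW /D AGS [in RHS]mulmxBl [in RHS]mulmxBr -!mulmxA orth_projector_id.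
by rewrite opprB addrA subrK mulmxBl -mulmxA.
Qed.

Lemma spectral_residual_le :
  spectral_norm D <= spectral_norm E * Num.sqrt (1 + (k * (n - k))%:R).
Proof.
have [W normW DW] := residual_factor.
apply: spectral_norm_leP => [|x]; first by rewrite mulr_ge0 ?spectral_norm_ge0 ?sqrtr_ge0.
apply: le_trans (DW _ x) _.
pose Q := 1%:M - V *m V^T.
have QV : Q^T *m V = 0.
  by rewrite /Q linearB /= trmx1 trmx_mul trmxK mulmxBl mul1mx -mulmxA VV mulmx1 subrr.
have QQ : Q *m Q = Q.
  by rewrite /Q {1}mulmxBr mulmx1 mulmxBl mul1mx mulmxA -(mulmxA V V^T)
    VV mulmx1 subrr subr0.
have -> : (E - E *m W *m V^T) *m x = E *m (Q *m x - W *m (V^T *m x)).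
  rewrite mulmxBl mulmxBr !mulmxA; congr (_ *m _ - _).
  by rewrite /E -mulmxA QQ.
apply: le_trans (sqfro_mul_spectral _ _) _.
rewrite exprMn sqr_sqrtr ?addr_ge0 // -[leRHS]mulrA ler_wpM2l ?sqr_ge0 //.
have -> : sqfro x = sqfro (Q *m x) + sqfro (V^T *m x).
  rewrite -(sqfro_mull_orth (V^T *m x) VV) -sqfro_addD.
    by rewrite mulmxA -mulmxDl subrK mul1mx.
  by rewrite trmx_mul mulmxA -(mulmxA x^T) QV mulmx0 mul0mx.
apply: sqfro_add_le; rewrite ?sqfro_ge0 // sqfroN.
by apply: le_trans (sqfro_mul_le _ _) _; rewrite ler_wpM2r ?sqfro_ge0.
Qed.

Lemma sqfro_residual_le :
  sqfro D <= sqfro E + (k * (n - k))%:R * spectral_norm E ^+ 2.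
Proof.
have [W normW /(_ _ 1%:M)] := residual_factor; rewrite !mulmx1 => DW.
apply: le_trans DW _; rewrite -sqfro_tr linearB /= sqfro_addD; last first.
  have EV : E *m V = 0.
    by rewrite -mulmxA mulmxBl mul1mx -mulmxA VV mulmx1 subrr mulmx0.
  by rewrite trmxK trmx_mul trmxK mulmxN mulmxA EV mul0mx oppr0.
rewrite sqfroN !sqfro_tr lerD2l sqfro_mulr_orth ?trmxK //.
by apply: le_trans (sqfro_mul_spectral _ _) _; rewrite mulrC ler_wpM2r ?sqr_ge0.
Qed.
End Residual.

Unset Implicit Arguments.

Theorem theorem4p4 (R : realType) (m n k : nat) (A : 'M[R]_(m, n))
    (hk : (k < \rank A)%N)
    (U : 'M[R]_m) (sigma : nat -> R) (V : 'M[R]_n)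
    (hsvd : is_svd A U sigma V)
    (Vhat : 'M[R]_(n, k)) (hVhat : Vhat^T *m Vhat = 1%:M)
    (C : {set 'I_n}) (hC : mgks_output Vhat C) :
  let Vk := leading_cols (ltn_rank_leq_col hk) V in
  let PC := orth_projector (cols_of A C) in
  let Ehat := A *m (1%:M - Vhat *m Vhat^T) in
  let Ek := A *m (1%:M - Vk *m Vk^T) in
  let r := frobenius_norm Ehat ^+ 2 / spectral_norm Ehat ^+ 2 in
  let eta2 := spectral_norm Ehat / spectral_norm Ek in
  let etaF := frobenius_norm Ehat / frobenius_norm Ek in
  spectral_norm (A - PC *m A)
    <= eta2 * Num.sqrt (1 + (k * (n - k))%N%:R) * sigma k.+1
  /\
  frobenius_norm (A - PC *m A)
    <= etaF * Num.sqrt (1 + (k * (n - k))%N%:R / r)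
       * Num.sqrt (\sum_(k.+1 <= i < (minn m n).+1) sigma i ^+ 2).
Proof.
move=> Vk PC Ehat Ek r eta2 etaF.
have Ehat0 : Ehat != 0 by exact: sub_rank_neq0.
have Ek0 : Ek != 0 by exact: sub_rank_neq0.
have [UU VV sigma_ge0 sigma_dec _] := hsvd.
have VV' : V *m V^T = 1%:M by exact: mulmx1C.
have EkE : Ek = U *m tail_sv m n k sigma *m V^T.
  exact: (sub_leading_svd (ltn_rank_leq_col hk) hsvd).
have kmn : (k < minn m n)%N.
  by rewrite leq_min !(leq_trans hk) ?rank_leq_row ?rank_leq_col.
split.
  have Ek_le : spectral_norm Ek <= sigma k.+1.
    apply: spectral_norm_leP => [|x]; first exact: sigma_ge0.
    rewrite EkE -!mulmxA sqfro_mull_orth //.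
    apply: le_trans (sqfro_tail_mul_le _ _ sigma_ge0 sigma_dec) _.
    by rewrite sqfro_mull_orth ?trmxK.
  apply: le_trans (spectral_residual_le _ hVhat hC) _.
  rewrite /eta2 [leRHS]mulrAC ler_wpM2r ?sqrtr_ge0 // -mulrA ler_peMr ?spectral_norm_ge0 //.
  by rewrite mulrC ler_pdivlMr ?spectral_norm_gt0 // mul1r.
have sqE : sqfro Ek = \sum_(k.+1 <= i < (minn m n).+1) sigma i ^+ 2.
  by rewrite EkE sqfro_mulr_orth ?trmxK // sqfro_mull_orth // sqfro_tail_sv.
rewrite -sqE /etaF -frobenius_normE mulrAC divfK; last first.
  by rewrite frobenius_normE sqrtr_eq0 -ltNge sqfro_gt0.
rewrite !frobenius_normE -sqrtrM ?sqfro_ge0 // ler_sqrt; last first.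
  rewrite mulr_ge0 ?sqfro_ge0 // addr_ge0 // divr_ge0 //.
  by rewrite divr_ge0 // sqr_ge0.
apply: le_trans (sqfro_residual_le _ hVhat hC) _.
rewrite /r frobenius_norm_sqr invf_div mulrDr mulr1 lerD2l.
by rewrite [leRHS]mulrC -[leRHS]mulrA divfK // sqfro_eq0.
Qed.
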